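(* Let $\Sigma$ be a set, $F$ a set of functions $f:\wp(\Sigma)^{n_f}\to\wp(\Sigma)$, and $(\mathcal{A},\le)$ a complete lattice together with maps $\alpha:\mathrm{Abs}(\wp(\Sigma))\to\mathcal{A}$, $\gamma:\mathcal{A}\to\mathrm{Abs}(\wp(\Sigma))$ forming a Galois insertion of $\mathcal{A}_{\ge}$ into $\mathrm{Abs}(\wp(\Sigma))_{\sqsupseteq}$, i.e. $\alpha,\gamma$ are monotone, $\alpha(X)\ge a \iff X\sqsupseteq\gamma(a)$ for all $X\in\mathrm{Abs}(\wp(\Sigma))$, $a\in\mathcal{A}$, and $\alpha(\gamma(a))=a$ for all $a$. Assume $(\mathcal{A},\le)$ satisfies the descending chain condition and that one of the following holds: (i) $\mathcal{A}$ is backward complete for $F^{\mathcal{M}}$, i.e. $\alpha\circ F^{\mathcal{M}}=\alpha\circ F^{\mathcal{M}}\circ\gamma\circ\alpha$; (ii) $\mathcal{A}$ is forward complete for $\mathscr{S}_F$, i.e. $\mathscr{S}_F\circ\gamma\circ\alpha=\gamma\circ\alpha\circ\mathscr{S}_F\circ\gamma\circ\alpha$. Then for every $a\in\mathcal{A}$, every run of the algorithm $\mathrm{GPT}^{\mathcal{A}}_F$ on input $a$ terminates and its output equals $\alpha(\mathscr{S}_F(\gamma(a)))$.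
   Context: An abstract domain of $\wp(\Sigma)$ is identified with a Moore family, i.e. a set $A\subseteq\wp(\Sigma)$ closed under arbitrary intersections (so $\Sigma\in A$); $\mathrm{Abs}(\wp(\Sigma))$ is the set of these. For $X\subseteq\wp(\Sigma)$, $\mathcal{M}(X)=\{\bigcap Y\mid Y\subseteq X\}$ (with $\bigcap\varnothing=\Sigma$). Order: $A_1\sqsubseteq A_2$ iff $A_2\subseteq A_1$; this is a complete lattice with meet $A_1\sqcap A_2=\mathcal{M}(A_1\cup A_2)$ and join given by intersection. For $X\subseteq\wp(\Sigma)$, $F(X)=\{f(\vec s)\mid f\in F,\ \vec s\in X^{n_f}\}$ and $F^{\mathcal{M}}(X)=\mathcal{M}(F(X))$. $A$ is forward $F$-complete if $F(A)\subseteq A$; $\mathscr{S}_F(A)=\bigsqcup\{X\mid X\sqsubseteq A,\ X\text{ forward }F\text{-complete}\}$ (the forward $F$-complete shell). For $f\in F$, $\vec S\in\wp(\Sigma)^{n_f}$ and abstract domain $A$: $\mathrm{refine}_f(\vec S,A)=\mathcal{M}(A\cup\{f(\vec S)\})$. For $a\in\mathcal{A}$: $\mathrm{refine}^{\mathcal{A}}_f(\vec S,a)=\alpha(\mathrm{refine}_f(\vec S,\gamma(a)))$; $\mathrm{refiners}^{\mathcal{A}}_f(a)=\{\vec S\in\gamma(a)^{n_f}\mid \mathrm{refine}^{\mathcal{A}}_f(\vec S,a)<a\}$; $\mathrm{refiners}^{\mathcal{A}}_F(a)=\bigcup_{f\in F}\mathrm{refiners}^{\mathcal{A}}_f(a)$.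 The nondeterministic algorithm $\mathrm{GPT}^{\mathcal{A}}_F$ on input $a$: while $\mathrm{refiners}^{\mathcal{A}}_F(a)\neq\varnothing$, choose some $f\in F$ and $\vec S\in\mathrm{refiners}^{\mathcal{A}}_f(a)$ and set $a:=\mathrm{refine}^{\mathcal{A}}_f(\vec S,a)$; output $a$. *)

(* Defs.v *)
From HB Require Import structures.
From mathcomp Require Import all_boot all_order.
From mathcomp Require Import mathcomp_extra boolp classical_sets.

Set Implicit Arguments.
Unset Strict Implicit.
Unset Printing Implicit Defensive.

Local Open Scope classical_set_scope.

Section AbstractDomains.
Variable Sigma : Type.

Definition moore_family (A : set (set Sigma)) : Prop :=
  forall Y : set (set Sigma), Y `<=` A -> A (\bigcap_(B in Y) B).

Record absdom : Type :=
  AbsDom { absdom_set :> set (set Sigma); absdomP : moore_family absdom_set }.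

Lemma absdom_eq (A1 A2 : absdom) : absdom_set A1 = absdom_set A2 -> A1 = A2.
Proof.
case: A1 A2 => [A1 p1] [A2 p2] /= E; move: p1 p2; rewrite E => p1 p2.
by rewrite (Prop_irrelevance p1 p2).
Qed.

HB.instance Definition _ := gen_eqMixin absdom.
HB.instance Definition _ := gen_choiceMixin absdom.

(* The precision order is reverse inclusion: smaller = more precise = more sets. *)
Definition absdom_le (A1 A2 : absdom) : bool :=
  `[< (A2 : set (set Sigma)) `<=` (A1 : set (set Sigma)) >].

Fact absdom_le_refl : reflexive absdom_le.
Proof. by move=> A; apply/asboolP. Qed.

Fact absdom_le_anti : antisymmetric absdom_le.
Proof.
move=> A1 A2 /andP[/asboolP le12 /asboolP le21].
by apply: absdom_eq; apply/seteqP; split.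
Qed.

Fact absdom_le_trans : transitive absdom_le.
Proof.
move=> A2 A1 A3 /asboolP le12 /asboolP le23.
by apply/asboolP => B /le23 /le12.
Qed.

Fact absdom_display : Order.disp_t. Proof. exact: (Order.Disp tt tt). Qed.

HB.instance Definition _ := Order.Le_isPOrder.Build absdom_display absdom
  absdom_le_refl absdom_le_anti absdom_le_trans.

Lemma absdom_leP (A1 A2 : absdom) :
  (A1 <= A2)%O <-> (A2 : set (set Sigma)) `<=` (A1 : set (set Sigma)).
Proof. by split=> [/asboolP|?] //; apply/asboolP. Qed.

Definition moore_set (X : set (set Sigma)) : set (set Sigma) :=
  [set Z | exists2 Y : set (set Sigma), Y `<=` X & Z = \bigcap_(B in Y) B].

Lemma moore_set_moore (X : set (set Sigma)) : moore_family (moore_set X).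
Proof.
move=> Y sYX.
exists [set B | X B /\ \bigcap_(Z in Y) Z `<=` B]; first by move=> B [].
apply/seteqP; split=> [x Yx B [_]|x capx Z YZ]; first exact.
have [W sWX defZ] := sYX _ YZ.
rewrite defZ => B WB; apply: capx; split; first exact: sWX.
by move=> y /(_ _ YZ); rewrite defZ; apply.
Qed.

Definition moore (X : set (set Sigma)) : absdom := AbsDom (@moore_set_moore X).

Fact bigcap_moore (D : set absdom) :
  moore_family (\bigcap_(X in D) (X : set (set Sigma))).
Proof. by move=> Y sYD X DX; apply: absdomP => B /sYD; apply. Qed.

Definition abs_join (D : set absdom) : absdom := AbsDom (@bigcap_moore D).

Lemma abs_join_supremum (D : set absdom) : supremums D (abs_join D).
Proof.
split=> [X DX|X ubX]; apply/absdom_leP => B; first exact.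
by move=> XB Z /ubX /absdom_leP; apply.
Qed.

Record operation : Type := Operation {
  arity : nat;
  op_fun :> arity.-tuple (set Sigma) -> set Sigma }.

Definition vectors (n : nat) (X : set (set Sigma)) : set (n.-tuple (set Sigma)) :=
  [set S | forall i : 'I_n, X (tnth S i)].

Definition op_image (F : set operation) (X : set (set Sigma)) : set (set Sigma) :=
  \bigcup_(f in F) (@op_fun f @` vectors X).

Definition op_moore (F : set operation) (X : set (set Sigma)) : absdom :=
  moore (op_image F X).

Definition forward_complete (F : set operation) (A : absdom) : Prop :=
  op_image F A `<=` A.

Definition forward_shell (F : set operation) (A : absdom) : absdom :=
  abs_join [set X : absdom | (X <= A)%O /\ forward_complete F X].

Definition refine (f : operation) (S : (arity f).-tuple (set Sigma))
    (A : absdom) : absdom :=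
  moore ((A : set (set Sigma)) `|` [set f S]).

End AbstractDomains.


Definition complete_lattice d (A : porderType d) : Prop :=
  forall X : set A, supremums X !=set0 /\ infimums X !=set0.

Definition descending_chain_condition d (A : porderType d) : Prop :=
  ~ exists u : nat -> A, forall n, (u n.+1 < u n)%O.

Section GPT.
Variables (Sigma : Type) (d : Order.disp_t) (A : porderType d).
Variables (alpha : absdom Sigma -> A) (gamma : A -> absdom Sigma).
Variable F : set (operation Sigma).

(* Both orders are reversed with respect to the usual orientation: alpha is the
   lower adjoint from (absdom, >=) to (A, >=). *)
Definition galois_insertion_ge : Prop :=
  [/\ {homo alpha : X Y / (X <= Y)%O},
      {homo gamma : a b / (a <= b)%O},
      forall (X : absdom Sigma) (a : A),
        (a <= alpha X)%O <-> (gamma a <= X)%O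
    & forall a : A, alpha (gamma a) = a].

Definition backward_complete_op_moore : Prop :=
  forall X : absdom Sigma,
    alpha (op_moore F X) = alpha (op_moore F (gamma (alpha X))).

Definition forward_complete_shell : Prop :=
  forall X : absdom Sigma,
    forward_shell F (gamma (alpha X)) =
    gamma (alpha (forward_shell F (gamma (alpha X)))).

Definition arefine (f : operation Sigma) (S : (arity f).-tuple (set Sigma))
    (a : A) : A :=
  alpha (refine S (gamma a)).

Definition refiners (f : operation Sigma) (a : A) :
    set ((arity f).-tuple (set Sigma)) :=
  [set S | vectors (gamma a) S /\ (arefine S a < a)%O].

(* Vectors of different arities are put in one union by forgetting the arity
   index of tuples. *)
Definition all_refiners (a : A) : set (seq (set Sigma)) :=
  \bigcup_(f in F) ((@tval _ _) @` @refiners f a).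

Definition gpt_step (a b : A) : Prop :=
  all_refiners a !=set0 /\
  exists2 f, F f & exists2 S, @refiners f a S & b = arefine S a.

(* [gpt_outputs a b]: some run on input [a] stops with output [b]. *)
Inductive gpt_outputs : A -> A -> Prop :=
| gpt_exit a : all_refiners a = set0 -> gpt_outputs a a
| gpt_loop a a' b : gpt_step a a' -> gpt_outputs a' b -> gpt_outputs a b.

Definition gpt_diverges (a : A) : Prop :=
  exists u : nat -> A, u 0 = a /\ forall n, gpt_step (u n) (u n.+1).

End GPT.

(* Main.v *)
Require Import Defs.
From mathcomp Require Import all_boot all_order.
From mathcomp Require Import mathcomp_extra boolp classical_sets.

(** Each of the two completeness hypotheses makes [gamma (alpha (forward_shell
    F (gamma a)))] forward complete. A refinement [a'] of [a] lies between [a]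
    and [alpha (forward_shell F (gamma a))], so this domain is also a forward
    complete refinement of [gamma a'], and the abstract shell is invariant along
    a run. On exit [gamma a] is forward complete, hence is its own shell. *)

Set Implicit Arguments.
Unset Strict Implicit.
Unset Printing Implicit Defensive.

Import Order.TTheory.
Local Open Scope classical_set_scope.
Local Open Scope order_scope.

Section ForwardShell.
Variables (Sigma : Type) (F : set (operation Sigma)).
Implicit Types (X Y Z : absdom Sigma) (T U : set (set Sigma)).

Lemma sub_moore T : T `<=` moore T.
Proof.
by move=> B TB; exists [set B] => [_ ->|] //; rewrite bigcap_set1.
Qed.

Lemma moore_sub T X : T `<=` X -> moore T `<=` X.
Proof.
by move=> sTX _ [V sVT ->]; apply: absdomP => B /sVT; apply: sTX.
Qed.

Lemma op_imageS T U : T `<=` U -> op_image F T `<=` op_image F U.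
Proof.
move=> sTU _ [f Ff [S TS <-]]; exists f => //; exists S => // i.
exact/sTU/TS.
Qed.

Lemma forward_shell_le X : forward_shell F X <= X.
Proof. by apply/absdom_leP => B XB Y [/absdom_leP sXY _]; apply: sXY. Qed.

(** A vector of the intersection is a vector of every member [Y], and completeness of [Y] keeps its
    image in [Y]. *)
Lemma forward_shell_complete X : forward_complete F (forward_shell F X).
Proof.
move=> B FB Y [leYX cY]; apply: (cY); apply: op_imageS FB => C shC.
exact: shC.
Qed.

Lemma le_forward_shell X Y :
  Y <= X -> forward_complete F Y -> Y <= forward_shell F X.
Proof. by move=> leYX cY; apply/absdom_leP => B; apply. Qed.

Lemma forward_shell_homo : {homo forward_shell F : X Y / X <= Y}.
Proof.
move=> X Y leXY; apply: le_forward_shell; last exact: forward_shell_complete.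
exact: le_trans (forward_shell_le X) leXY.
Qed.

Lemma forward_shell_id X : forward_complete F X -> forward_shell F X = X.
Proof.
by move=> cX; apply: le_anti; rewrite forward_shell_le le_forward_shell.
Qed.

Lemma refine_le (f : operation Sigma) (S : (arity f).-tuple (set Sigma)) X :
  refine S X <= X.
Proof. by apply/absdom_leP => B XB; apply: sub_moore; left. Qed.

(** The shell contains [X] and is closed under [f], so it contains [f S]; being a Moore family, it
    contains the whole closure. *)
Lemma forward_shell_le_refine (f : operation Sigma)
    (S : (arity f).-tuple (set Sigma)) X :
  F f -> vectors X S -> forward_shell F X <= refine S X.
Proof.
move=> Ff XS; apply/absdom_leP/moore_sub => B [XB|->].
  by have /absdom_leP := forward_shell_le X; apply.
apply: forward_shell_complete; exists f => //; exists S => // i.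
by have /absdom_leP := forward_shell_le X; apply; apply: XS.
Qed.

End ForwardShell.

Section Run.
Variables (Sigma : Type) (F : set (operation Sigma)).
Variables (d : Order.disp_t) (A : porderType d).
Variables (alpha : absdom Sigma -> A) (gamma : A -> absdom Sigma).
Hypothesis hgi : galois_insertion_ge alpha gamma.

Let alpha_homo : {homo alpha : X Y / X <= Y}. Proof. by case: hgi. Qed.
Let gamma_homo : {homo gamma : a b / a <= b}. Proof. by case: hgi. Qed.
Let gammaK a : alpha (gamma a) = a. Proof. by case: hgi. Qed.

Let gamma_alpha_le X : gamma (alpha X) <= X.
Proof. by case: hgi => _ _ adj _; apply/adj. Qed.

(** Forward completeness of [X] amounts to [X <= op_moore F X]. Applying [gamma] after [alpha] and
    then backward completeness moves this inequality to [gamma (alpha X)]. *)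
Lemma backward_complete_forward (X : absdom Sigma) :
  backward_complete_op_moore alpha gamma F -> forward_complete F X ->
  forward_complete F (gamma (alpha X)).
Proof.
move=> bc cX; apply: subset_trans (@sub_moore _ _) _; apply/absdom_leP.
apply: le_trans (gamma_alpha_le (op_moore F (gamma (alpha X)))).
by rewrite -bc; apply/gamma_homo/alpha_homo/absdom_leP/moore_sub.
Qed.

Lemma gamma_alpha_shell_complete (a : A) :
  backward_complete_op_moore alpha gamma F \/
    forward_complete_shell alpha gamma F ->
  forward_complete F (gamma (alpha (forward_shell F (gamma a)))).
Proof.
case=> [bc|fc].
  exact: backward_complete_forward bc (@forward_shell_complete _ _ _).
(* At [gamma a] the inner [alpha (gamma a)] collapses to [a], so the domain in the goal is the shell
   itself. *)
have := fc (gamma a); rewrite gammaK => <-.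
exact: forward_shell_complete.
Qed.

Lemma arefine_le (f : operation Sigma) (S : (arity f).-tuple (set Sigma))
    (a : A) :
  arefine alpha gamma S a <= a.
Proof. by rewrite -[leRHS]gammaK; apply/alpha_homo/refine_le. Qed.

Lemma gpt_step_lt (a b : A) : gpt_step alpha gamma F a b -> b < a.
Proof. by case=> _ [f _ [S [_ ltSa] ->]]. Qed.

Lemma gpt_step_shell (a b : A) :
  forward_complete F (gamma (alpha (forward_shell F (gamma a)))) ->
  gpt_step alpha gamma F a b ->
  alpha (forward_shell F (gamma b)) = alpha (forward_shell F (gamma a)).
Proof.
move=> cB [_ [f Ff [S [aS _] ->]]]; apply: le_anti; apply/andP; split.
  exact/alpha_homo/forward_shell_homo/gamma_homo/arefine_le.
(* Written as [alpha (gamma _)], the left side is the image of a domain that [cB] makes forward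
   complete, so maximality of the shell applies. *)
rewrite -[leLHS]gammaK; apply/alpha_homo/le_forward_shell => //.
exact/gamma_homo/alpha_homo/forward_shell_le_refine.
Qed.

(** Without refiners, refining by any vector of [gamma a] gives back [a]. Since
    [gamma (alpha X) <= X], the refined domain is then included in [gamma a], and it contains
    [f S]. *)
Lemma all_refiners0_complete (a : A) :
  all_refiners alpha gamma F a = set0 -> forward_complete F (gamma a).
Proof.
move=> ref0 _ [f Ff [S aS <-]].
have arefS : arefine alpha gamma S a = a.
  have := arefine_le S a; rewrite le_eqVlt => /orP[/eqP //|ltSa].
  have : all_refiners alpha gamma F a (tval S) by exists f => //; exists S.
  by rewrite ref0.
have /absdom_leP := gamma_alpha_le (refine S (gamma a)).
rewrite -/(arefine alpha gamma S a) arefS; apply.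
by apply: sub_moore; right.
Qed.

End Run.

Theorem theorem4p3 (Sigma : Type) (F : set (operation Sigma))
    (d : Order.disp_t) (A : porderType d)
    (alpha : absdom Sigma -> A) (gamma : A -> absdom Sigma)
    (hA : complete_lattice A)
    (hgi : galois_insertion_ge alpha gamma)
    (hdcc : descending_chain_condition A)
    (hcompl : backward_complete_op_moore alpha gamma F \/
              forward_complete_shell alpha gamma F) :
  forall a : A,
    ~ gpt_diverges alpha gamma F a /\
    (forall b : A, gpt_outputs alpha gamma F a b ->
       b = alpha (forward_shell F (gamma a))).
Proof.
move=> a; split=> [[u [_ stepu]]|b].
  (* Refiners lower [a] strictly, so an infinite run is an infinite descending chain. *)
  by apply: hdcc; exists u => n; apply: gpt_step_lt (stepu n).
elim=> [{}a ref0|{}a a' {}b stepa _ ->].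
  have cg := all_refiners0_complete hgi ref0.
  by rewrite forward_shell_id //; case: hgi.
exact: (gpt_step_shell hgi (gamma_alpha_shell_complete hgi hcompl) stepa).
Qed.
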